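(* Let $f$ satisfy the standing assumptions and let $\beta>0$. Then for any $z,\xi\in\mathbb{R}^{n+m}$, $$\left|h_\beta(z+\xi)-h_\beta(z)-\nabla h_\beta(z)^\top\xi-\frac12\xi^\top\bar H(z)\xi\right|\le\frac{(3\beta L+1)\rho}{6}\|\xi\|^3+\frac{\beta\rho}{2}\|\nabla_yf(z)\|\,\|\xi\|^2.$$
   Context: Write $z=(x,y)\in\mathbb{R}^n\times\mathbb{R}^m=\mathbb{R}^{n+m}$. $\|\cdot\|$ is the Euclidean norm for vectors and the spectral norm for matrices. Standing assumptions on $f:\mathbb{R}^n\times\mathbb{R}^m\to\mathbb{R}$: $f$ is thrice continuously differentiable; for each $x$, $f(x,\cdot)$ is $\mu$-strongly concave ($\mu>0$); for each $y$, $f(\cdot,y)$ is possibly nonconvex; $\|\nabla f(z+\xi)-\nabla f(z)\|\le L\|\xi\|$ and $\|\nabla^2 f(z+\xi)-\nabla^2 f(z)\|\le\rho\|\xi\|$ for all $z,\xi\in\mathbb{R}^{n+m}$; and $\inf_x\max_{y}f(x,y)>-\infty$. $h_\beta(z):=f(z)+\frac{\beta}{2}\|\nabla_yf(z)\|^2$; $P:=\begin{pmatrix}0&0\\0&I_m\end{pmatrix}$; $\bar H(z):=\nabla^2f(z)+\beta\nabla^2f(z)P\nabla^2f(z)$. *)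

(* Defs.v *)
From HB Require Import structures.
From mathcomp Require Import all_boot all_order all_algebra.
From mathcomp Require Import all_classical all_reals all_analysis.

Set Implicit Arguments.
Unset Strict Implicit.
Unset Printing Implicit Defensive.

Import Order.TTheory GRing.Theory Num.Theory.
Import numFieldNormedType.Exports.

Local Open Scope classical_set_scope.
Local Open Scope ring_scope.

(* The canonical norm `|v| on 'cV[R]_p is the sup norm, hence the separate
   definitions of the Euclidean and spectral norms. The sup norm induces the
   same topology and the same derivatives as the Euclidean one. *)
Definition enorm (R : realType) (p : nat) (v : 'cV[R]_p) : R :=
  Num.sqrt (\sum_(i < p) v i 0 ^+ 2).

Definition spectral_norm (R : realType) (p q : nat) (A : 'M[R]_(p, q)) : R :=
  sup [set enorm (A *m v) | v in [set v : 'cV[R]_q | enorm v <= 1]].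

Definition partial (R : realType) (p : nat) (i : 'I_p) (f : 'cV[R]_p -> R)
    : 'cV[R]_p -> R :=
  fun z => 'D_(delta_mx i 0) f z.

Definition grad (R : realType) (p : nat) (f : 'cV[R]_p -> R) (z : 'cV[R]_p)
    : 'cV[R]_p :=
  \col_(i < p) partial i f z.

Definition hess (R : realType) (p : nat) (f : 'cV[R]_p -> R) (z : 'cV[R]_p)
    : 'M[R]_p :=
  \matrix_(i < p, j < p) partial i (partial j f) z.

(* f is C^k: for k > 0, f is (Frechet) differentiable everywhere and the
   components of its derivative are C^(k-1). *)
Fixpoint continuously_differentiable (R : realType) (p k : nat)
    (f : 'cV[R]_p -> R) : Prop :=
  match k with
  | 0 => continuous f
  | k'.+1 => (forall z, differentiable f z) /\
             (forall i : 'I_p, continuously_differentiable k' (partial i f))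
  end.

Definition strongly_concave (R : realType) (p : nat) (mu : R)
    (g : 'cV[R]_p -> R) : Prop :=
  forall (u v : 'cV[R]_p) (t : R), 0 <= t <= 1 ->
    t * g u + (1 - t) * g v + mu / 2 * (t * (1 - t)) * enorm (u - v) ^+ 2
      <= g (t *: u + (1 - t) *: v).

(* A point z = (x, y) of R^n x R^m is encoded as col_mx x y. *)
Definition grad_y (R : realType) (n m : nat) (f : 'cV[R]_(n + m) -> R)
    (z : 'cV[R]_(n + m)) : 'cV[R]_m :=
  dsubmx (grad f z).

Definition h_ (R : realType) (n m : nat) (beta : R) (f : 'cV[R]_(n + m) -> R)
    (z : 'cV[R]_(n + m)) : R :=
  f z + beta / 2 * enorm (grad_y f z) ^+ 2.

Definition Pmx (R : realType) (n m : nat) : 'M[R]_(n + m) :=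
  block_mx 0 0 0 1%:M.

Definition Hbar (R : realType) (n m : nat) (beta : R)
    (f : 'cV[R]_(n + m) -> R) (z : 'cV[R]_(n + m)) : 'M[R]_(n + m) :=
  hess f z + beta *: (hess f z *m Pmx R n m *m hess f z).

(* Main.v *)
Require Import Defs.
From HB Require Import structures.
From mathcomp Require Import all_boot all_order all_algebra.
From mathcomp Require Import all_classical all_reals all_analysis.
From mathcomp Require Import ring lra.

Set Implicit Arguments.
Unset Strict Implicit.
Unset Printing Implicit Defensive.

Import Order.TTheory GRing.Theory Num.Theory.
Import numFieldNormedType.Exports.

Local Open Scope classical_set_scope.
Local Open Scope ring_scope.

(** Write [g] for the gradient and [H] for the Hessian of [f] at [z], and let
    [a], [d], [D] be the [y]-components of [g], of [grad f (z + xi) - g] and of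
    [H xi].  Differentiating the penalty [beta / 2 * |grad_y f|^2] gives
    [grad h = g + beta H P g], and [|grad_y f (z + xi)|^2] is [|a + d|^2].
    Since [H] is symmetric, [xi^T H P H xi = |D|^2], and the error of the
    expansion of [h] splits exactly as

      (second-order Taylor error of [f])
        + beta (a . (d - D)) + (beta / 2) ((d - D) . (d + D)).

    The first term is at most [rho / 6 * |xi|^3] ([taylor_order2]).  The vector
    [d - D] is part of the first-order Taylor error of the gradient, so it has
    norm at most [rho / 2 * |xi|^2] ([grad_taylor]).  Both [d] and [D] have norm
    at most [L |xi|], the latter because a Lipschitz constant of the gradient
    bounds the Hessian ([enorm_hess_mulmx_le]).  Cauchy-Schwarz then bounds
    the second term by [beta * rho / 2 * |a| |xi|^2] and the third by
    [beta * L * rho / 2 * |xi|^3].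

    The Taylor estimates reduce to the mean value theorem in one variable, by
    restricting to a line and pairing vectors with a fixed test vector
    ([normr_increment_le]).  The symmetry of [H] ([hess_sym]) comes out of the
    same estimates: they identify [dot u (H v)] with the leading term of
    a second difference of [f], which does not see the order of [u] and [v]. *)

(** * Euclidean geometry of column vectors *)

Definition dot (R : realType) (p : nat) (u v : 'cV[R]_p) : R :=
  (u^T *m v) 0 0.

Lemma dotE (R : realType) (p : nat) (u v : 'cV[R]_p) :
  dot u v = \sum_(i < p) u i 0 * v i 0.
Proof. by rewrite /dot mxE; apply: eq_bigr => i _; rewrite mxE. Qed.

Lemma dotC (R : realType) (p : nat) (u v : 'cV[R]_p) : dot u v = dot v u.
Proof. by rewrite !dotE; apply: eq_bigr => i _; rewrite mulrC. Qed.

Lemma dotDr (R : realType) (p : nat) (u v w : 'cV[R]_p) :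
  dot u (v + w) = dot u v + dot u w.
Proof. by rewrite /dot mulmxDr mxE. Qed.

Lemma dotNr (R : realType) (p : nat) (u v : 'cV[R]_p) : dot u (- v) = - dot u v.
Proof. by rewrite /dot mulmxN mxE. Qed.

Lemma dotBr (R : realType) (p : nat) (u v w : 'cV[R]_p) :
  dot u (v - w) = dot u v - dot u w.
Proof. by rewrite dotDr dotNr. Qed.

Lemma dotZr (R : realType) (p : nat) (a : R) (u v : 'cV[R]_p) :
  dot u (a *: v) = a * dot u v.
Proof. by rewrite /dot -scalemxAr mxE. Qed.

Lemma dotDl (R : realType) (p : nat) (u v w : 'cV[R]_p) :
  dot (u + v) w = dot u w + dot v w.
Proof. by rewrite ![dot _ w]dotC dotDr. Qed.

Lemma dotBl (R : realType) (p : nat) (u v w : 'cV[R]_p) :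
  dot (u - v) w = dot u w - dot v w.
Proof. by rewrite ![dot _ w]dotC dotBr. Qed.

Lemma dotZl (R : realType) (p : nat) (a : R) (u v : 'cV[R]_p) :
  dot (a *: u) v = a * dot u v.
Proof. by rewrite ![dot _ v]dotC dotZr. Qed.

Lemma dot_mulmx (R : realType) (p q : nat) (u : 'cV[R]_p) (A : 'M[R]_(p, q))
    (v : 'cV[R]_q) :
  dot u (A *m v) = dot (A^T *m u) v.
Proof. by rewrite /dot trmx_mul trmxK mulmxA. Qed.

Lemma enorm_ge0 (R : realType) (p : nat) (v : 'cV[R]_p) : 0 <= enorm v.
Proof. exact: sqrtr_ge0. Qed.

Lemma enorm_sqr (R : realType) (p : nat) (v : 'cV[R]_p) :
  enorm v ^+ 2 = dot v v.
Proof.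
rewrite sqr_sqrtr ?sumr_ge0// => [|i _]; last exact: sqr_ge0.
by rewrite dotE; apply: eq_bigr => i _; rewrite expr2.
Qed.

Lemma enormZ (R : realType) (p : nat) (a : R) (v : 'cV[R]_p) :
  enorm (a *: v) = `|a| * enorm v.
Proof.
apply/eqP; rewrite -(@eqrXn2 _ 2)// ?enorm_ge0 ?mulr_ge0 ?enorm_ge0//.
by rewrite exprMn !enorm_sqr dotZl dotZr mulrA -expr2 real_normK ?num_real.
Qed.

Lemma enorm0 (R : realType) (p : nat) : enorm (0 : 'cV[R]_p) = 0.
Proof. by rewrite /enorm big1 ?sqrtr0// => i _; rewrite mxE expr0n. Qed.

Lemma enorm_eq0 (R : realType) (p : nat) (v : 'cV[R]_p) :
  enorm v = 0 -> v = 0.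
Proof.
move=> v0; have := enorm_sqr v; rewrite v0 expr0n/= dotE => /esym/eqP.
rewrite psumr_eq0 => [/allP h|i _]; last by rewrite -expr2 sqr_ge0.
apply/colP => i; rewrite mxE; apply/eqP.
by have := h i (mem_index_enum _); rewrite -expr2 sqrf_eq0.
Qed.

(** Cauchy-Schwarz, by expanding the squared norm of [|v| u - |u| v]. *)
Lemma dot_le (R : realType) (p : nat) (u v : 'cV[R]_p) :
  dot u v <= enorm u * enorm v.
Proof.
have [u0|u_neq0] := eqVneq (enorm u) 0.
  by rewrite (enorm_eq0 u0) /dot trmx0 mul0mx mxE mulr_ge0 ?enorm_ge0.
have [v0|v_neq0] := eqVneq (enorm v) 0.
  by rewrite (enorm_eq0 v0) /dot mulmx0 mxE mulr_ge0 ?enorm_ge0.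
have uv_gt0 : 0 < enorm u * enorm v.
  by rewrite mulr_gt0// lt_neqAle eq_sym enorm_ge0 ?u_neq0 ?v_neq0.
have := sqr_ge0 (enorm (enorm v *: u - enorm u *: v)).
rewrite enorm_sqr dotBl !dotBr !dotZl !dotZr -!enorm_sqr [dot v u]dotC => h.
rewrite -(ler_pM2l uv_gt0); nra.
Qed.

Lemma normr_dot_le (R : realType) (p : nat) (u v : 'cV[R]_p) :
  `|dot u v| <= enorm u * enorm v.
Proof.
rewrite ler_norml dot_le andbT lerNl -dotNr (le_trans (dot_le _ _))//.
by rewrite -scaleN1r enormZ normrN normr1 mul1r.
Qed.

(** Testing a vector against itself turns bounds on its components into a
    bound on its norm. *)
Lemma enorm_le_dual (R : realType) (p : nat) (v : 'cV[R]_p) (M : R) :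
  0 <= M -> (forall c, dot c v <= enorm c * M) -> enorm v <= M.
Proof.
move=> M0 /(_ v); rewrite -enorm_sqr expr2.
have [->//|v_neq0] := eqVneq (enorm v) 0.
by rewrite ler_pM2l// lt_neqAle eq_sym v_neq0 enorm_ge0.
Qed.

(** The Frobenius norm as a crude bound: it makes the supremum that defines
    the spectral norm a genuine one. *)
Lemma enorm_mulmx_bounded (R : realType) (p q : nat) (A : 'M[R]_(p, q)) :
  exists M, forall v, enorm v <= 1 -> enorm (A *m v) <= M.
Proof.
exists (Num.sqrt (\sum_i enorm (row i A)^T ^+ 2)) => v v1.
apply: ler_wsqrtr; apply: ler_sum => i _.
have -> : (A *m v) i 0 = dot (row i A)^T v.
  by rewrite /dot trmxK !mxE; apply: eq_bigr => j _; rewrite mxE.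
rewrite -[leLHS]real_normK ?num_real// lerXn2r ?nnegrE ?enorm_ge0//.
by rewrite (le_trans (normr_dot_le _ _))// ler_piMr ?enorm_ge0.
Qed.

Lemma enorm_mulmx_le (R : realType) (p q : nat) (A : 'M[R]_(p, q))
    (v : 'cV[R]_q) :
  enorm (A *m v) <= spectral_norm A * enorm v.
Proof.
have [v0|v_neq0] := eqVneq (enorm v) 0.
  by rewrite v0 mulr0 (enorm_eq0 v0) mulmx0 enorm0.
have v_gt0 : 0 < enorm v by rewrite lt_neqAle eq_sym v_neq0 enorm_ge0.
rewrite -ler_pdivrMr// mulrC.
have -> : (enorm v)^-1 * enorm (A *m v) = enorm (A *m ((enorm v)^-1 *: v)).
  by rewrite -scalemxAr enormZ ger0_norm// invr_ge0 ltW.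
have [M AM] := enorm_mulmx_bounded A.
apply: ub_le_sup; first by exists M => _ [w w1 <-]; exact: AM.
exists ((enorm v)^-1 *: v) => //=.
by rewrite enormZ ger0_norm ?invr_ge0 ?(ltW v_gt0)// mulVf.
Qed.

Lemma dot_col_mx (R : realType) (n m : nat) (u v : 'cV[R]_(n + m)) :
  dot u v = dot (usubmx u) (usubmx v) + dot (dsubmx u) (dsubmx v).
Proof.
by rewrite !dotE big_split_ord; congr +%R; apply: eq_bigr => i _; rewrite !mxE.
Qed.

Lemma enorm_dsubmx_le (R : realType) (n m : nat) (u : 'cV[R]_(n + m)) :
  enorm (dsubmx u) <= enorm u.
Proof.
rewrite -(@ler_pXn2r _ 2)// ?nnegrE ?enorm_ge0// !enorm_sqr dot_col_mx.
by rewrite lerDr -enorm_sqr sqr_ge0.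
Qed.

Lemma dot_Pmx (R : realType) (n m : nat) (u v : 'cV[R]_(n + m)) :
  dot u (Pmx R n m *m v) = dot (dsubmx u) (dsubmx v).
Proof.
rewrite -[v in LHS]vsubmxK /Pmx mul_block_col !mul0mx mul1mx !add0r.
by rewrite dot_col_mx col_mxKu col_mxKd /dot mulmx0 mxE add0r.
Qed.

Lemma spectral_norm_ge0 (R : realType) (p q : nat) (A : 'M[R]_(p, q)) :
  0 <= spectral_norm A.
Proof.
have [M AM] := enorm_mulmx_bounded A.
apply: ub_le_sup; first by exists M => _ [w w1 <-]; exact: AM.
by exists 0; rewrite /= ?mulmx0 !enorm0.
Qed.

(** * Calculus along a segment *)

(** The mean value theorem applied to [phi t - C / (k + 1) * t ^ (k + 1)]. *)
Lemma increment_le (R : realType) (phi dphi : R -> R) (C : R) (k : nat) :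
  (forall t : R, is_derive t (1 : R) phi (dphi t)) ->
  (forall t, 0 <= t <= 1 -> dphi t <= C * t ^+ k) ->
  phi 1 - phi 0 <= C / k.+1%:R.
Proof.
move=> dphiP dphi_le.
pose F := phi - (C / k.+1%:R) \*: (@id R ^+ k.+1).
have dF (t : R) : is_derive t (1 : R) F (dphi t - C * t ^+ k).
  apply: is_derive_eq; rewrite /=; congr (_ - _).
  by rewrite /GRing.scale/= mulr1 mulrA divfK// pnatr_eq0.
have [t t01 Ft] : exists2 t, t \in `]0, 1[%R &
    F 1 - F 0 = (dphi t - C * t ^+ k) * (1 - 0).
  apply: MVT => //; apply: derivable_within_continuous => t _.
  by have [] := dF t.
have F1 : F 1 = phi 1 - C / k.+1%:R.
  by rewrite /F !fctE /= expr1n /GRing.scale/= mulr1.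
have F0 : F 0 = phi 0.
  by rewrite /F !fctE /= expr0n/= /GRing.scale/= mulr0 subr0.
move: t01 Ft; rewrite in_itv/= => /andP[t0 t1].
rewrite subr0 mulr1 F1 F0 => Ft.
have : dphi t <= C * t ^+ k by rewrite dphi_le// !ltW.
by rewrite -subr_le0 -Ft addrAC subr_le0.
Qed.

Lemma normr_increment_le (R : realType) (phi dphi : R -> R) (C : R) (k : nat) :
  (forall t : R, is_derive t (1 : R) phi (dphi t)) ->
  (forall t, 0 <= t <= 1 -> `|dphi t| <= C * t ^+ k) ->
  `|phi 1 - phi 0| <= C / k.+1%:R.
Proof.
move=> dphiP dphi_le; rewrite ler_norml; apply/andP; split; last first.
  by apply: increment_le dphiP _ => t /dphi_le; rewrite ler_norml => /andP[].
have dN (t : R) : is_derive t (1 : R) (- phi) (- dphi t) by apply: is_deriveN.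
rewrite lerNl opprB addrC -[phi 0]opprK; apply: (increment_le dN) => t.
by move=> /dphi_le; rewrite ler_norml lerNl => /andP[].
Qed.

(** Stands in for the limit [t -> 0] in an inequality valid for all small
    [t]. *)
Lemma le_of_le_add_small (R : realType) (A B K : R) :
  (forall t, 0 < t -> A <= B + t * K) -> A <= B.
Proof.
move=> AB; rewrite leNgt; apply/negP => BA.
have K1 : 0 < `|K| + 1 by rewrite ltr_wpDl.
(* This [t] makes [t * K] smaller than the gap [A - B]. *)
have /AB : 0 < (A - B) / (`|K| + 1) by rewrite divr_gt0// subr_gt0.
rewrite -lerBlDl mulrAC ler_pdivlMr// leNgt => /negP; apply.
by rewrite ltr_pM2l ?subr_gt0// (le_lt_trans (ler_norm _))// ltrDl.
Qed.

Lemma derive_grad (R : realType) (p : nat) (g : 'cV[R]_p -> R)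
    (z v : 'cV[R]_p) :
  differentiable g z -> 'D_v g z = dot (grad g z) v.
Proof.
move=> dg; rewrite deriveE// [v in LHS]matrix_sum_delta linear_sum/= dotE.
apply: eq_bigr => i _; rewrite big_ord1 linearZ/= mxE /partial deriveE//.
by rewrite /GRing.scale/= mulrC.
Qed.

(** The difference quotient of [s |-> g (z + s v)] at [t] is literally that of
    [g] at [z + t v] in the direction [v]. *)
Lemma is_derive_line (R : realType) (p : nat) (g : 'cV[R]_p -> R)
    (z v : 'cV[R]_p) (t : R) :
  differentiable g (z + t *: v) ->
  is_derive t (1 : R) (fun s : R => g (z + s *: v))
    (dot (grad g (z + t *: v)) v).
Proof.
move=> dg.
have quotE : (fun h : R => h^-1 *: (((fun s : R => g (z + s *: v)) \o shift t)
      (h *: 1) - g (z + t *: v))) =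
    (fun h : R => h^-1 *: ((g \o shift (z + t *: v)) (h *: v)
      - g (z + t *: v))).
  apply/funext => h /=; have -> : h *: (1 : R) = h by exact: mulr1.
  by rewrite scalerDl addrCA.
split; first by rewrite /derivable quotE; exact: diff_derivable.
by rewrite -derive_grad// /derive quotE.
Qed.

(** * Functions with a Lipschitz Hessian *)

Section LipschitzHessian.
Variables (R : realType) (p : nat) (f : 'cV[R]_p -> R) (rho : R).
Hypothesis f_diff : forall z, differentiable f z.
Hypothesis df_diff : forall i z, differentiable (partial i f) z.
Hypothesis f_hess_lip : forall z xi : 'cV[R]_p,
  spectral_norm (hess f (z + xi) - hess f z) <= rho * enorm xi.

(** The transpose comes from the index convention of [hess], whose columns are
    the gradients of the first partial derivatives; it disappears once
    [hess_sym] is available, and the lemmas before that one keep it. *)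
Lemma is_derive_dot_grad_line (c z v : 'cV[R]_p) (t : R) :
  is_derive t (1 : R) (fun s : R => dot c (grad f (z + s *: v)))
    (dot c ((hess f (z + t *: v))^T *m v)).
Proof.
have -> : (fun s : R => dot c (grad f (z + s *: v))) =
    \sum_(i < p) (c i 0 \*: (fun s : R => partial i f (z + s *: v))).
  apply/funext => s; rewrite dotE fct_sumE; apply: eq_bigr => i _.
  by rewrite mxE.
have dfi (i : 'I_p) := is_derive_line (df_diff i (z + t *: v)).
apply: is_derive_eq; rewrite dotE; apply: eq_bigr => i _.
rewrite /GRing.scale/=; congr (_ * _); rewrite dotE mxE.
by apply: eq_bigr => j _; rewrite !mxE.
Qed.

Lemma hess_lip_bound_ge0 (z xi : 'cV[R]_p) : 0 <= rho * enorm xi.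
Proof. exact: le_trans (spectral_norm_ge0 _) (f_hess_lip z xi). Qed.

Lemma hess_lip_dot (z eta c v : 'cV[R]_p) :
  `|dot c ((hess f (z + eta))^T *m v) - dot c ((hess f z)^T *m v)|
    <= enorm c * (rho * enorm eta) * enorm v.
Proof.
rewrite -dotBr -mulmxBl -linearB/= dot_mulmx trmxK dotC.
rewrite (le_trans (normr_dot_le _ _))// mulrC ler_wpM2r ?enorm_ge0//.
rewrite (le_trans (enorm_mulmx_le _ _))// mulrC.
by rewrite ler_wpM2l ?enorm_ge0.
Qed.

(** Along the segment, the derivative of the paired Taylor error is the
    variation of the Hessian between [z] and [z + t xi], of order [t]. *)
Lemma grad_taylor_dot (z xi c : 'cV[R]_p) :
  `|dot c (grad f (z + xi) - grad f z - (hess f z)^T *m xi)|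
    <= enorm c * (rho / 2 * enorm xi ^+ 2).
Proof.
pose phi := (fun t : R => dot c (grad f (z + t *: xi)))
  - (dot c ((hess f z)^T *m xi)) \*: @id R.
pose dphi t := dot c ((hess f (z + t *: xi))^T *m xi)
  - dot c ((hess f z)^T *m xi).
have dphiP (t : R) : is_derive t (1 : R) phi (dphi t).
  have := is_derive_dot_grad_line c z xi t => ?.
  by apply: is_derive_eq; rewrite /dphi /GRing.scale/= mulr1.
have dphi_le t : 0 <= t <= 1 ->
    `|dphi t| <= enorm c * rho * enorm xi ^+ 2 * t ^+ 1.
  move=> /andP[t0 _]; rewrite (le_trans (hess_lip_dot _ _ _ _))//.
  by rewrite enormZ ger0_norm// le_eqVlt; apply/orP; left; apply/eqP; ring.
have := normr_increment_le dphiP dphi_le.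
rewrite /phi !fctE /= scale1r scale0r addr0 /GRing.scale/= mulr1 mulr0 subr0.
rewrite !dotBr addrAC => /le_trans; apply.
by rewrite le_eqVlt; apply/orP; left; apply/eqP; field.
Qed.

(** Along the segment, the derivative of the Taylor error of [f] is the
    Taylor error of its gradient at [t xi] paired with [xi], of order
    [t ^ 2]. *)
Lemma taylor_order2 (z xi : 'cV[R]_p) :
  `|f (z + xi) - f z - dot (grad f z) xi - dot xi ((hess f z)^T *m xi) / 2|
    <= rho / 6 * enorm xi ^+ 3.
Proof.
pose q := dot xi ((hess f z)^T *m xi).
pose psi := (fun t : R => f (z + t *: xi)) - (dot (grad f z) xi) \*: @id R
  - (q / 2) \*: (@id R ^+ 2).
pose dpsi t := dot (grad f (z + t *: xi)) xi - dot (grad f z) xi - q * t.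
have dpsiP (t : R) : is_derive t (1 : R) psi (dpsi t).
  have := is_derive_line (f_diff (z + t *: xi)) => ?.
  apply: is_derive_eq; rewrite /dpsi /GRing.scale/= !mulr1 expr1.
  by congr (_ - _); field.
have dpsi_le t : 0 <= t <= 1 ->
    `|dpsi t| <= rho / 2 * enorm xi ^+ 3 * t ^+ 2.
  move=> /andP[t0 _]; have := grad_taylor_dot z (t *: xi) xi.
  rewrite !dotBr -scalemxAr dotZr -/q ![dot xi (grad _ _)]dotC [t * q]mulrC.
  rewrite enormZ [`|t|]ger0_norm// => /le_trans; apply.
  by rewrite le_eqVlt; apply/orP; left; apply/eqP; ring.
have := normr_increment_le dpsiP dpsi_le.
rewrite /psi !fctE /= scale1r scale0r addr0 expr1n expr0n/= /GRing.scale/=.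
rewrite !mulr1 !mulr0 !subr0 -/q.
set A := (X in `|X| <= _ -> _); set B := (X in _ -> `|X| <= _).
have -> : B = A by rewrite /A /B; ring.
move=> /le_trans; apply.
by rewrite le_eqVlt; apply/orP; left; apply/eqP; field.
Qed.

(** As a function of [s], the difference [f (z + v + s u) - f (z + s u)] has
    derivative [u . (grad f (z + s u + v) - grad f (z + s u))], which is [u]
    paired with the Hessian at [z + s u] applied to [v] up to [grad_taylor_dot];
    the Lipschitz condition then moves the Hessian back to [z]. *)
Lemma second_difference (z u v : 'cV[R]_p) :
  `|f (z + v + u) - f (z + u) - (f (z + v) - f z) - dot u ((hess f z)^T *m v)|
    <= rho * (enorm u * enorm v * (enorm v / 2 + enorm u)).
Proof.
pose q := dot u ((hess f z)^T *m v).
pose phi := (fun s : R => f (z + v + s *: u)) - (fun s : R => f (z + s *: u))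
  - q \*: @id R.
pose dphi s :=
  dot (grad f (z + v + s *: u)) u - dot (grad f (z + s *: u)) u - q.
have dphiP (s : R) : is_derive s (1 : R) phi (dphi s).
  have := is_derive_line (f_diff (z + v + s *: u)) => ?.
  have := is_derive_line (f_diff (z + s *: u)) => ?.
  by apply: is_derive_eq; rewrite /dphi /GRing.scale/= mulr1.
have dphi_le s : 0 <= s <= 1 ->
    `|dphi s| <= rho * (enorm u * enorm v * (enorm v / 2 + enorm u)) * s ^+ 0.
  move=> /andP[s0 s1].
  have -> : dphi s =
      dot u (grad f (z + s *: u + v) - grad f (z + s *: u)
              - (hess f (z + s *: u))^T *m v)
      + (dot u ((hess f (z + s *: u))^T *m v) - q).
    by rewrite /dphi !dotBr ![dot u (grad _ _)]dotC [z + v + _]addrAC; ring.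
  rewrite (le_trans (ler_normD _ _))//.
  rewrite (le_trans (lerD (grad_taylor_dot _ _ _) (hess_lip_dot _ _ _ _)))//.
  have : enorm (s *: u) <= enorm u.
    by rewrite enormZ ger0_norm// ler_piMl ?enorm_ge0.
  have := hess_lip_bound_ge0 z u; have := enorm_ge0 u.
  have := enorm_ge0 v; rewrite enormZ ger0_norm// expr0 mulr1.
  set a := enorm u; set b := enorm v => b0 a0 ra0 _.
  have : (a * b) * (s * (rho * a)) <= (a * b) * (rho * a).
    by rewrite ler_wpM2l ?mulr_ge0// ler_piMl.
  by lra.
have := normr_increment_le dphiP dphi_le.
rewrite /phi !fctE /= !scale1r !scale0r !addr0 /GRing.scale/= !mulr1 !mulr0.
rewrite subr0 divr1 -/q.
set A := (X in `|X| <= _ -> _); set B := (X in _ -> `|X| <= _).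
by have -> : B = A by rewrite /A /B; ring.
Qed.

(** Schwarz's theorem: the second difference of [f] in the directions [t u]
    and [t v] is symmetric in [u] and [v], and it is [t ^ 2] times the second
    derivative up to [O(t ^ 3)]. *)
Lemma hess_dot_sym (z u v : 'cV[R]_p) :
  dot u ((hess f z)^T *m v) = dot v ((hess f z)^T *m u).
Proof.
suff le_sym (a b : 'cV[R]_p) :
    dot a ((hess f z)^T *m b) <= dot b ((hess f z)^T *m a).
  by apply/eqP; rewrite eq_le !le_sym.
pose K (x y : 'cV[R]_p) := rho * (enorm x * enorm y * (enorm y / 2 + enorm x)).
apply: (@le_of_le_add_small _ _ _ (K a b + K b a)) => t t0.
have := second_difference z (t *: a) (t *: b).
have := second_difference z (t *: b) (t *: a).
rewrite [z + t *: a + _]addrAC -!scalemxAr !dotZl !dotZr !enormZ.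
rewrite [`|t|]gtr0_norm//.
set D := f (z + t *: b + t *: a); rewrite !ler_norml.
move=> /andP[_ h1] /andP[h2 _].
rewrite -(ler_pM2l (exprn_gt0 2 t0)) /K; lra.
Qed.

Lemma hess_sym (z : 'cV[R]_p) : (hess f z)^T = hess f z.
Proof.
have entryE (A : 'M[R]_p) i j : dot (delta_mx i 0) (A *m delta_mx j 0) = A i j.
  by rewrite /dot trmx_delta -rowE -colE !mxE.
apply/matrixP => i j; rewrite -entryE hess_dot_sym entryE mxE //.
Qed.

Lemma grad_taylor (z xi : 'cV[R]_p) :
  enorm (grad f (z + xi) - grad f z - hess f z *m xi)
    <= rho / 2 * enorm xi ^+ 2.
Proof.
rewrite -hess_sym; apply: enorm_le_dual => [|c]; last first.
  exact: le_trans (ler_norm _) (grad_taylor_dot _ _ _).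
have := hess_lip_bound_ge0 z xi; have := enorm_ge0 xi; nra.
Qed.

(** The Lipschitz condition gives [|grad f (z + t xi) - grad f z| <= t L |xi|]
    for small [t > 0]; divide by [t] and let [t] tend to [0]. *)
Lemma enorm_hess_mulmx_le (L : R) (z xi : 'cV[R]_p) :
  (forall w v, enorm (grad f (w + v) - grad f w) <= L * enorm v) ->
  enorm (hess f z *m xi) <= L * enorm xi.
Proof.
move=> g_lip; apply: enorm_le_dual => [|c].
  exact: le_trans (enorm_ge0 _) (g_lip z xi).
apply: (@le_of_le_add_small _ _ _ (enorm c * (rho / 2 * enorm xi ^+ 2))).
move=> t t0; rewrite -(ler_pM2l t0).
have := grad_taylor_dot z (t *: xi) c.
rewrite dotBr hess_sym -scalemxAr dotZr ler_norml => /andP[h _].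
have := dot_le c (grad f (z + t *: xi) - grad f z).
have := ler_wpM2l (enorm_ge0 c) (g_lip z (t *: xi)).
move: h; rewrite enormZ [`|t|]gtr0_norm//; lra.
Qed.

End LipschitzHessian.

(** * The penalized function *)

Lemma grad_h (R : realType) (n m : nat) (beta : R) (f : 'cV[R]_(n + m) -> R)
    (z : 'cV[R]_(n + m)) :
  differentiable f z -> (forall i, differentiable (partial i f) z) ->
  grad (h_ beta f) z
    = grad f z + beta *: (hess f z *m (Pmx R n m *m grad f z)).
Proof.
move=> df ddf; apply/colP => i.
have hE : h_ beta f = f + (beta / 2) \*:
    \sum_(j < m) (partial (rshift n j) f ^+ 2).
  apply/funext => w; rewrite /h_ enorm_sqr !fctE fct_sumE dotE.
  congr (_ + _ * _); apply: eq_bigr => j _.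
  by rewrite !mxE expr2.
have dfi : is_derive z (delta_mx i 0) f (partial i f z).
  exact/derivableP/diff_derivable.
have ddfi (j : 'I_m) : is_derive z (delta_mx i 0) (partial (rshift n j) f)
    (partial i (partial (rshift n j) f) z).
  exact/derivableP/diff_derivable.
have -> : (hess f z *m (Pmx R n m *m grad f z)) = \col_k
    dot (dsubmx (row k (hess f z))^T) (dsubmx (grad f z)).
  apply/colP => k; rewrite [RHS]mxE -dot_Pmx /dot trmxK mxE [RHS]mxE.
  by apply: eq_bigr => l _; rewrite [row _ _ _ _]mxE.
rewrite !mxE {1}/partial hE derive_val; congr (_ + _).
rewrite dotE scaler_sumr mulr_sumr; apply: eq_bigr => j _.
by rewrite /GRing.scale/= !mxE expr1; field.
Qed.

Theorem proposition3p2 (R : realType) (n m : nat)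
  (f : 'cV[R]_(n + m) -> R) (mu L rho beta : R)
  (f_C3 : continuously_differentiable 3 f)
  (mu_gt0 : 0 < mu)
  (f_concave : forall x : 'cV[R]_n,
     strongly_concave mu (fun y : 'cV[R]_m => f (col_mx x y)))
  (f_grad_lip : forall z xi : 'cV[R]_(n + m),
     enorm (grad f (z + xi) - grad f z) <= L * enorm xi)
  (f_hess_lip : forall z xi : 'cV[R]_(n + m),
     spectral_norm (hess f (z + xi) - hess f z) <= rho * enorm xi)
  (f_bounded : (-oo < ereal_inf (range (fun x : 'cV[R]_n =>
     ereal_sup (range (fun y : 'cV[R]_m => (f (col_mx x y))%:E)))))%E)
  (beta_gt0 : 0 < beta) :
  forall z xi : 'cV[R]_(n + m),
    `| h_ beta f (z + xi) - h_ beta f z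
       - ((grad (h_ beta f) z)^T *m xi) 0 0
       - 1 / 2 * (xi^T *m Hbar beta f z *m xi) 0 0 |
    <= (3 * beta * L + 1) * rho / 6 * enorm xi ^+ 3
       + beta * rho / 2 * enorm (grad_y f z) * enorm xi ^+ 2.
Proof.
have [f_diff f_C2] := f_C3.
have df_diff i := (f_C2 i).1.
move=> z xi.
pose g := grad f z; pose H := hess f z; pose e := grad f (z + xi) - g.
pose r := e - H *m xi.
have H_sym : H^T = H := hess_sym f_diff df_diff f_hess_lip z.
have r_le : enorm (dsubmx r) <= rho / 2 * enorm xi ^+ 2.
  apply: le_trans (enorm_dsubmx_le _) _.
  exact: grad_taylor f_diff df_diff f_hess_lip z xi.
have e_le : enorm (dsubmx e) <= L * enorm xi.
  exact: le_trans (enorm_dsubmx_le _) (f_grad_lip z xi).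
have D_le : enorm (dsubmx (H *m xi)) <= L * enorm xi.
  apply: le_trans (enorm_dsubmx_le _) _.
  exact: enorm_hess_mulmx_le f_diff df_diff f_hess_lip L z xi f_grad_lip.
have ft := taylor_order2 f_diff df_diff f_hess_lip z xi.
rewrite -/H -/g H_sym in ft.
rewrite -mulmxA -!/(dot _ _) grad_h// -/g -/H.
have -> : dot (g + beta *: (H *m (Pmx R n m *m g))) xi
    = dot g xi + beta * dot (dsubmx g) (dsubmx (H *m xi)).
  rewrite dotDl dotZl [dot (H *m _) xi]dotC dot_mulmx H_sym dot_Pmx.
  by rewrite [dot (dsubmx (H *m xi)) _]dotC.
have -> : dot xi (Hbar beta f z *m xi)
    = dot xi (H *m xi) + beta * dot (dsubmx (H *m xi)) (dsubmx (H *m xi)).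
  rewrite /Hbar -/H mulmxDl dotDr -scalemxAl dotZr -!mulmxA.
  by rewrite [dot xi (H *m (Pmx _ _ _ *m _))]dot_mulmx H_sym dot_Pmx.
rewrite -[1 / 2]/(1 * 2^-1) mul1r /h_ !(enorm_sqr (grad_y _ _)) /grad_y -/g.
pose a := dsubmx g; pose d := dsubmx e; pose D := dsubmx (H *m xi).
have -> : dsubmx (grad f (z + xi)) = a + d.
  by rewrite /a /d -linearD/= /e [g + _]addrC subrK.
have rE : dsubmx r = d - D by rewrite /r linearB.
rewrite rE in r_le.
have a_r : `|dot a (d - D)| <= enorm a * (rho / 2 * enorm xi ^+ 2).
  by rewrite (le_trans (normr_dot_le _ _))// ler_wpM2l ?enorm_ge0.
have r_w w : enorm w <= L * enorm xi ->
    `|dot (d - D) w| <= rho / 2 * enorm xi ^+ 2 * (L * enorm xi).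
  move=> w_le; rewrite (le_trans (normr_dot_le _ _))//.
  by rewrite ler_pM ?enorm_ge0.
have := r_w _ e_le; have := r_w _ D_le; move: a_r.
rewrite -/a -/d -/D !dotBr !dotBl !dotDl !dotDr [dot d a]dotC [dot D d]dotC.
move: ft; rewrite !ler_norml.
move=> /andP[f1 f2] /andP[a1 a2] /andP[D1 D2] /andP[d1 d2].
(* Once multiplied by [beta], the bounds are linear in the monomials of the
   goal. *)
have := ler_wpM2l (ltW beta_gt0) a1; have := ler_wpM2l (ltW beta_gt0) a2.
have := ler_wpM2l (ltW beta_gt0) D1; have := ler_wpM2l (ltW beta_gt0) D2.
have := ler_wpM2l (ltW beta_gt0) d1; have := ler_wpM2l (ltW beta_gt0) d2.
move=> ? ? ? ? ? ?; apply/andP; split; lra.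
Qed.
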